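(* $[\llcorner]\subsetneq[\llcorner,\urcorner]\subsetneq \text{Helly-}B_1\text{-EPG}$, and the class Helly-$B_1$-EPG is incomparable (under inclusion) with each of the classes $[\llcorner,\ulcorner]$ and $[\llcorner,\ulcorner,\urcorner]$.
   Context: A grid is the set of integer points of the plane; a grid edge joins two grid points at distance $1$. A path in the grid is a sequence of distinct grid edges in which consecutive edges share exactly one grid point and non-consecutive edges share none; a bend is a pair of consecutive edges with different directions (horizontal/vertical). An EPG representation of a graph $G$ is a family $(P_v)_{v\in V(G)}$ of grid paths such that distinct $u,v$ are adjacent iff $P_u,P_v$ share a grid edge; it is $B_1$-EPG if every path has at most one bend, and is Helly if every subfamily of pairwise edge-intersecting paths has a grid edge common to all its members. Helly-$B_1$-EPG is the class of graphs admitting a Helly $B_1$-EPG representation. A one-bend path has one of the four shapes $\llcorner,\lrcorner,\ulcorner,\urcorner$ (according to which two directions leave its bend point). For $S\subseteq\{\llcorner,\lrcorner,\ulcorner,\urcorner\}$, $[S]$ denotes the class of graphs having a $B_1$-EPG representation in which every path has a shape in $S$, where paths with no bend are regarded as degenerate $\llcorner$'s. *)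

(* Defs.v *)
From mathcomp Require Import all_boot.
From Stdlib Require Import ZArith.

Set Implicit Arguments.
Unset Strict Implicit.
Unset Printing Implicit Defensive.

Definition simple_graph (T : finType) (e : rel T) : Prop :=
  irreflexive e /\ symmetric e.

(** Grid edges.  [HE (a,b)] is the edge joining (a,b) and (a+1,b);
    [VE (a,b)] is the edge joining (a,b) and (a,b+1). *)
Inductive gedge : Type :=
| HE : Z -> Z -> gedge
| VE : Z -> Z -> gedge.

(** A grid path with at most one bend.  [BP x y h v] has its (potential) bend
    point at (x,y), a horizontal arm from (x,y) to (x+h,y) and a vertical arm
    from (x,y) to (x,y+v).  It is a genuine path (at least one edge) iff
    h <> 0 or v <> 0; it has exactly one bend iff h <> 0 and v <> 0.
    Every grid path with at most one bend arises this way. *)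
Record bpath : Type := BP { bx : Z; by_ : Z; bh : Z; bv : Z }.

Definition nonempty_path (p : bpath) : Prop := (bh p <> 0 \/ bv p <> 0)%Z.

Definition on_path (g : gedge) (p : bpath) : Prop :=
  match g with
  | HE a b => b = by_ p /\ (Z.min (bx p) (bx p + bh p) <= a < Z.max (bx p) (bx p + bh p))%Z
  | VE a b => a = bx p /\ (Z.min (by_ p) (by_ p + bv p) <= b < Z.max (by_ p) (by_ p + bv p))%Z
  end.

Definition edge_meet (p q : bpath) : Prop := exists g, on_path g p /\ on_path g q.

(** The four shapes, named after the directions leaving the bend point:
    SLL = ⌞ (right, up), SLR = ⌟ (left, up),
    SUL = ⌜ (right, down), SUR = ⌝ (left, down). *)
Inductive shape : Type := SLL | SLR | SUL | SUR.

(** Shape of a path with exactly one bend (h <> 0, v <> 0). *)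
Definition bend_shape (p : bpath) : shape :=
  if (0 <? bh p)%Z then (if (0 <? bv p)%Z then SLL else SUL)
  else (if (0 <? bv p)%Z then SLR else SUR).

(** A path has a shape in S; paths with no bend count as degenerate ⌞'s. *)
Definition shape_in (S : shape -> Prop) (p : bpath) : Prop :=
  if ((bh p =? 0) || (bv p =? 0))%Z then S SLL else S (bend_shape p).

Definition B1_EPG_rep (T : finType) (e : rel T) (P : T -> bpath) : Prop :=
  (forall v, nonempty_path (P v)) /\
  (forall u v, u <> v -> (e u v <-> edge_meet (P u) (P v))).

Definition helly_family (T : finType) (P : T -> bpath) : Prop :=
  forall A : {set T},
    (forall u v, u \in A -> v \in A -> edge_meet (P u) (P v)) ->
    exists g, forall u, u \in A -> on_path g (P u).

Definition graph_class := forall T : finType, rel T -> Prop.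

Definition shape_class (S : shape -> Prop) : graph_class :=
  fun T e => exists P : T -> bpath, B1_EPG_rep e P /\ forall v, shape_in S (P v).

Definition Helly_B1_EPG : graph_class :=
  fun T e => exists P : T -> bpath, B1_EPG_rep e P /\ helly_family P.

Definition subclass (C D : graph_class) : Prop :=
  forall (T : finType) (e : rel T), simple_graph e -> C T e -> D T e.

Definition separates (C D : graph_class) : Prop :=
  exists (T : finType) (e : rel T), simple_graph e /\ C T e /\ ~ D T e.

Definition proper_subclass (C D : graph_class) : Prop :=
  subclass C D /\ separates D C.

Definition incomparable (C D : graph_class) : Prop :=
  separates C D /\ separates D C.

Definition S_LL : shape -> Prop := fun s => s = SLL.
Definition S_LL_UR : shape -> Prop := fun s => s = SLL \/ s = SUR.
Definition S_LL_UL : shape -> Prop := fun s => s = SLL \/ s = SUL.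
Definition S_LL_UL_UR : shape -> Prop := fun s => s = SLL \/ s = SUL \/ s = SUR.

(* Main.v *)
(** Two paths can be adjacent through their horizontal or their vertical arms.
    For ⌞'s and ⌝'s a clique always uses one of the two throughout, since two
    such paths with a common bend point share both arm directions or none; the
    Helly property then reduces to the one on a line.

    The 3-sun is not Helly: paths through the common edge of the central
    triangle diverge once on either side of it, so on each side the pairwise
    intersections are nested, and two of the three outer vertices lie on the
    same side.  It is represented by a ⌞, a ⌜ and a vertical path at a point.

    In K_{2,4} with parts {p,q} and {b1,...,b4}, classify each b by the arms
    with which it meets p and q.  At most one b is of type HH and one of type
    VV; two b's of type HV bend at (x_q, y_p), in opposite directions, and p, q
    cross there.  So either all four types occur, and then all four shapes
    do, or p, q cross twice and each crossing carries two b's with opposite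
    shapes.  The first case and the second are both impossible in [⌞].
    In [⌞,⌜,⌝] only the second survives, with b's of shapes ⌞ and ⌝; a further
    vertex adjacent to exactly two b's forces these to lie at different
    crossings and to have the same shape.  Linking b1 and b2 both to b4 is then
    contradictory, although it is possible with four shapes; and the linked
    graph is bipartite, so all its representations are Helly. *)
Require Import Defs.
From mathcomp Require Import all_boot.
From Stdlib Require Import ZArith Lia.

Set Implicit Arguments.
Unset Strict Implicit.
Unset Printing Implicit Defensive.

(** * Edge intersection as overlap of arms, and graphs given by lists of paths *)

Definition hmeet (p q : bpath) : Prop :=
  by_ p = by_ q /\
  (Z.max (Z.min (bx p) (bx p + bh p)) (Z.min (bx q) (bx q + bh q)) <
   Z.min (Z.max (bx p) (bx p + bh p)) (Z.max (bx q) (bx q + bh q)))%Z.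

Definition vmeet (p q : bpath) : Prop :=
  bx p = bx q /\
  (Z.max (Z.min (by_ p) (by_ p + bv p)) (Z.min (by_ q) (by_ q + bv q)) <
   Z.min (Z.max (by_ p) (by_ p + bv p)) (Z.max (by_ q) (by_ q + bv q)))%Z.

Definition meets (p q : bpath) : Prop := hmeet p q \/ vmeet p q.

(** A strict inequality between the larger left end and the smaller right end gives a common unit
    edge, not just a common point; the first such edge is the witness. *)
Lemma edge_meetE (p q : bpath) : edge_meet p q <-> meets p q.
Proof.
split.
- by case=> -[] x y /= [[Hp Ip] [Hq Iq]]; [left | right]; split; lia.
- case=> -[E I].
  + exists (HE (Z.max (Z.min (bx p) (bx p + bh p)) (Z.min (bx q) (bx q + bh q)))
               (by_ p)) => /=; lia.
  + exists (VE (bx p) (Z.max (Z.min (by_ p) (by_ p + bv p))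
                             (Z.min (by_ q) (by_ q + bv q)))) => /=; lia.
Qed.

Definition hmeetb (p q : bpath) : bool :=
  ((by_ p =? by_ q) &&
   (Z.max (Z.min (bx p) (bx p + bh p)) (Z.min (bx q) (bx q + bh q)) <?
    Z.min (Z.max (bx p) (bx p + bh p)) (Z.max (bx q) (bx q + bh q))))%Z.

Definition vmeetb (p q : bpath) : bool :=
  ((bx p =? bx q) &&
   (Z.max (Z.min (by_ p) (by_ p + bv p)) (Z.min (by_ q) (by_ q + bv q)) <?
    Z.min (Z.max (by_ p) (by_ p + bv p)) (Z.max (by_ q) (by_ q + bv q))))%Z.

Lemma hmeetP (p q : bpath) : reflect (hmeet p q) (hmeetb p q).
Proof.
by apply: (iffP andP) => -[/Z.eqb_eq E /Z.ltb_lt I].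
Qed.

Lemma vmeetP (p q : bpath) : reflect (vmeet p q) (vmeetb p q).
Proof.
by apply: (iffP andP) => -[/Z.eqb_eq E /Z.ltb_lt I].
Qed.

Lemma meetsP (p q : bpath) : reflect (meets p q) (hmeetb p q || vmeetb p q).
Proof.
apply: (iffP orP) => -[].
- by move/hmeetP; left.
- by move/vmeetP; right.
- by move/hmeetP; left.
- by move/vmeetP; right.
Qed.

Lemma hmeetC (p q : bpath) : hmeet p q -> hmeet q p.
Proof. by case=> E I; split; lia. Qed.

Lemma vmeetC (p q : bpath) : vmeet p q -> vmeet q p.
Proof. by case=> E I; split; lia. Qed.

Lemma meetsC (p q : bpath) : meets p q -> meets q p.
Proof. by case=> [/hmeetC | /vmeetC]; [left | right]. Qed.

(** Boolean, so that adjacency in a concrete graph is settled by computation. The empty default path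
    of [nth] is never reached. *)
Definition epg_graph (ps : seq bpath) : rel 'I_(size ps) :=
  fun u v => (u != v) &&
    let p i := nth (BP 0 0 0 0)%Z ps i in
    hmeetb (p u) (p v) || vmeetb (p u) (p v).

Lemma epg_graph_simple (ps : seq bpath) : simple_graph (@epg_graph ps).
Proof.
split=> [u | u v]; first by rewrite /epg_graph eqxx.
rewrite /epg_graph eq_sym; congr (_ && _) => /=.
by apply/meetsP/meetsP => /meetsC.
Qed.

Lemma epg_graph_rep (ps : seq bpath) :
    (forall p, List.In p ps -> nonempty_path p) ->
  B1_EPG_rep (@epg_graph ps) (fun u => nth (BP 0 0 0 0)%Z ps u).
Proof.
move=> ne; split=> [v | u v /eqP uv].
- apply: ne; case: v => i /= lti.
  elim: ps i lti => [|p ps IH] [|i] //= lti; first by left.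
  by right; apply: IH.
- by rewrite edge_meetE /epg_graph uv /=; split=> /meetsP.
Qed.

Lemma epg_graph_shape (S : Defs.shape -> Prop) (ps : seq bpath) :
    (forall p, List.In p ps -> nonempty_path p /\ shape_in S p) ->
  shape_class S (@epg_graph ps).
Proof.
move=> ok; exists (fun u : 'I_(size ps) => nth (BP 0 0 0 0)%Z ps u); split.
- by apply: epg_graph_rep => p /ok [].
- case=> i /= lti; have [] // : nonempty_path (nth (BP 0 0 0 0)%Z ps i) /\
    shape_in S (nth (BP 0 0 0 0)%Z ps i).
  apply: ok; elim: ps i lti => [|p ps IH] [|i] //= lti; first by left.
  by right; apply: IH.
Qed.

Lemma shape_class_mono (S S' : Defs.shape -> Prop) :
  (forall s, S s -> S' s) -> subclass (shape_class S) (shape_class S').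
Proof.
move=> SS' T e _ [P [rep sh]]; exists P; split=> // v.
by move: (sh v); rewrite /shape_in; case: ifP => _; apply: SS'.
Qed.

(** * Paths of shapes ⌞ and ⌝ form Helly families *)

Lemma shape_LL_UR_signs (p : bpath) : shape_in S_LL_UR p ->
  (bh p = 0 \/ bv p = 0 \/ (0 < bh p /\ 0 < bv p) \/ (bh p < 0 /\ bv p < 0))%Z.
Proof.
rewrite /shape_in /S_LL_UR /bend_shape.
case: (Z.eqb_spec (bh p) 0) => h0 /=; first by lia.
case: (Z.eqb_spec (bv p) 0) => v0 /=; first by lia.
by case: (Z.ltb_spec 0 (bh p)); case: (Z.ltb_spec 0 (bv p)); try lia; move=> _ _ [].
Qed.

Lemma hmeet_neq0 (p q : bpath) : hmeet p q -> bh p <> 0%Z /\ bh q <> 0%Z.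
Proof. by case=> _ I; lia. Qed.

Lemma vmeet_neq0 (p q : bpath) : vmeet p q -> bv p <> 0%Z /\ bv q <> 0%Z.
Proof. by case=> _ I; lia. Qed.

Lemma hmeet_same_corner (p q : bpath) : bx p = bx q -> by_ p = by_ q ->
  hmeet p q <-> ((0 < bh p /\ 0 < bh q) \/ (bh p < 0 /\ bh q < 0))%Z.
Proof. by move=> ex ey; split=> [[_ I] | H]; [| split]; lia. Qed.

Lemma vmeet_same_corner (p q : bpath) : bx p = bx q -> by_ p = by_ q ->
  vmeet p q <-> ((0 < bv p /\ 0 < bv q) \/ (bv p < 0 /\ bv q < 0))%Z.
Proof. by move=> ex ey; split=> [[_ I] | H]; [| split]; lia. Qed.

(** Whichever way [q] and [r] meet, one of them has the bend point of [p]; two such paths of shapes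
    ⌞ and ⌝ agree in both directions or in neither. *)
Lemma LL_UR_no_mixed_triangle (p q r : bpath) :
    shape_in S_LL_UR p -> shape_in S_LL_UR q -> shape_in S_LL_UR r ->
    hmeet p q -> ~ vmeet p q -> vmeet p r -> ~ hmeet p r -> ~ meets q r.
Proof.
move=> /shape_LL_UR_signs sp /shape_LL_UR_signs sq /shape_LL_UR_signs sr.
move=> hpq nvpq vpr nhpr mqr.
have [hp hq] := hmeet_neq0 hpq; have [vp vr] := vmeet_neq0 vpr.
have [eypq _] := hpq; have [expr _] := vpr.
case: mqr => [hqr | vqr].
- have [eyqr _] := hqr; have [_ hr] := hmeet_neq0 hqr.
  move: nhpr vpr; rewrite hmeet_same_corner ?vmeet_same_corner; lia.
- have [exqr _] := vqr; have [vq _] := vmeet_neq0 vqr.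
  move: nvpq hpq; rewrite vmeet_same_corner ?hmeet_same_corner; lia.
Qed.

Lemma LL_UR_one_direction (T : finType) (P : T -> bpath) (A : {set T}) :
    (forall v, shape_in S_LL_UR (P v)) ->
    (forall u v, u \in A -> v \in A -> meets (P u) (P v)) ->
  (forall u v, u \in A -> v \in A -> hmeet (P u) (P v)) \/
  (forall u v, u \in A -> v \in A -> vmeet (P u) (P v)).
Proof.
move=> sh mt.
case: (boolP [forall u in A, forall v in A, hmeetb (P u) (P v)]) => [H | nH].
  by left=> u v uA vA; move/forall_inP: H => /(_ _ uA) /forall_inP /(_ _ vA) /hmeetP.
case: (boolP [forall u in A, forall v in A, vmeetb (P u) (P v)]) => [H | nV].
  by right=> u v uA vA; move/forall_inP: H => /(_ _ uA) /forall_inP /(_ _ vA) /vmeetP.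
exfalso.
move: nH; rewrite negb_forall_in => /exists_inP [p pA].
rewrite negb_forall_in => /exists_inP [q qA /hmeetP npq].
move: nV; rewrite negb_forall_in => /exists_inP [r rA].
rewrite negb_forall_in => /exists_inP [s sA /vmeetP nrs].
have vpq : vmeet (P p) (P q) by case: (mt p q pA qA).
have hrs : hmeet (P r) (P s) by case: (mt r s rA sA).
have nqp : ~ hmeet (P q) (P p) by move/hmeetC.
have nsr : ~ vmeet (P s) (P r) by move/vmeetC.
have both x x' y y' : x \in A -> x' \in A -> y \in A -> y' \in A ->
    vmeet (P x) (P x') -> ~ hmeet (P x) (P x') ->
    hmeet (P y) (P y') -> ~ vmeet (P y) (P y') ->
    hmeet (P x) (P y) /\ vmeet (P x) (P y).
  move=> xA xA' yA yA' V nH H nV.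
  case: (hmeetP (P x) (P y)) => hxy; case: (vmeetP (P x) (P y)) => vxy //.
  - exfalso; apply: (LL_UR_no_mixed_triangle (sh x) (sh y) (sh x') hxy vxy V nH).
    exact: mt.
  - exfalso; apply: (LL_UR_no_mixed_triangle (sh y) (sh y') (sh x) H nV).
    + exact: vmeetC.
    + by move/hmeetC.
    + exact: mt.
  - by case: (mt x y xA yA).
(* Meeting [r] both ways, [p] and [q] have its bend point and the direction of its horizontal arm,
   so they meet horizontally. *)
have [hpr vpr] := both _ _ _ _ pA qA rA sA vpq npq hrs nrs.
have [hqr vqr] := both _ _ _ _ qA pA rA sA (vmeetC vpq) nqp hrs nrs.
apply: npq; have [exp _] := vpr; have [exq _] := vqr.
have [eyp _] := hpr; have [eyq _] := hqr.
by move: hpr hqr; rewrite !hmeet_same_corner; lia.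
Qed.

Lemma arg_max_Z (T : finType) (A : {set T}) (f : T -> Z) (x0 : T) :
  x0 \in A -> exists2 m, m \in A & forall x, x \in A -> (f x <= f m)%Z.
Proof.
move=> x0A.
have [m mA mP] : exists2 m, m \in x0 :: enum A &
    forall x, x \in x0 :: enum A -> (f x <= f m)%Z.
  elim: (enum A) => [|y s [m ms IH]].
    by exists x0 => [|x]; rewrite ?inE // => /eqP ->; lia.
  case: (Z_le_gt_dec (f y) (f m)) => [le | gt].
  - exists m => [|x]; first by move: ms; rewrite !inE => /orP [->|->]; rewrite ?orbT.
    rewrite !inE => /or3P [/eqP -> | /eqP -> // | xs]; apply: IH; first by rewrite inE eqxx.
    by rewrite inE xs orbT.
  - exists y => [|x]; first by rewrite !inE eqxx orbT.
    rewrite !inE => /or3P [/eqP -> | /eqP -> | xs]; last first.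
    + by have := IH x; rewrite inE xs orbT => /(_ isT); lia.
    + lia.
    + by have := IH x0; rewrite inE eqxx => /(_ isT); lia.
exists m => [|x xA]; last by apply: mP; rewrite inE mem_enum xA orbT.
by move: mA; rewrite inE mem_enum => /orP [/eqP -> |].
Qed.

Lemma LL_UR_helly (T : finType) (P : T -> bpath) :
  (forall v, shape_in S_LL_UR (P v)) -> helly_family P.
Proof.
move=> sh A mt.
have [-> | [x0 x0A]] := set_0Vmem A; first by exists (HE 0 0) => u; rewrite inE.
have mt' u v : u \in A -> v \in A -> meets (P u) (P v).
  by move=> uA vA; apply/edge_meetE/mt.
have [H | V] := LL_UR_one_direction sh mt'.
(* The arm whose left end is rightmost: its first edge lies on all the others. *)
- have [m mA mP] := arg_max_Z (fun u => Z.min (bx (P u)) (bx (P u) + bh (P u))) x0A.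
  exists (HE (Z.min (bx (P m)) (bx (P m) + bh (P m))) (by_ (P m))) => u uA.
  by have := mP u uA; have [] := H u m uA mA; rewrite /=; lia.
- have [m mA mP] := arg_max_Z (fun u => Z.min (by_ (P u)) (by_ (P u) + bv (P u))) x0A.
  exists (VE (bx (P m)) (Z.min (by_ (P m)) (by_ (P m) + bv (P m)))) => u uA.
  by have := mP u uA; have [] := V u m uA mA; rewrite /=; lia.
Qed.

Lemma LL_UR_sub_Helly : subclass (shape_class S_LL_UR) Helly_B1_EPG.
Proof. by move=> T e _ [P [rep sh]]; exists P; split=> //; apply: LL_UR_helly. Qed.

(** * The 3-sun *)

Definition flip (p : bpath) : bpath := BP (by_ p) (bx p) (bv p) (bh p).
Definition flip_edge (g : gedge) : gedge :=
  match g with HE a b => VE b a | VE a b => HE b a end.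

Lemma on_path_flip (g : gedge) (p : bpath) :
  on_path (flip_edge g) (flip p) <-> on_path g p.
Proof. by case: g => a b. Qed.

(** Tells the sides of [HE x0 y0] apart on a path through it: a vertical edge has the abscissa of
    the bend, at most [x0] on the left and at least [x0 + 1] on the right. *)
Definition xcoord (g : gedge) : Z := match g with HE a _ => a | VE a _ => a end.

(* On each side of the horizontal edge, the intersections of [p] with [q] and
   with [r] are nested: one-bend paths do not meet again after diverging. *)
Lemma same_side_nested (x0 y0 : Z) (p q r : bpath) (g g' : gedge) :
    on_path (HE x0 y0) p -> on_path (HE x0 y0) q -> on_path (HE x0 y0) r ->
    (x0 < xcoord g <-> x0 < xcoord g')%Z ->
    on_path g p -> on_path g q -> on_path g' p -> on_path g' r ->
  on_path g r \/ on_path g' q.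
Proof.
by case: g => a b; case: g' => a' b' /=; lia.
Qed.

Lemma no_sun_at_hedge (x0 y0 : Z) (p q r : bpath) (g1 g2 g3 : gedge) :
    on_path (HE x0 y0) p -> on_path (HE x0 y0) q -> on_path (HE x0 y0) r ->
    on_path g1 p -> on_path g1 q -> ~ on_path g1 r ->
    on_path g2 q -> on_path g2 r -> ~ on_path g2 p ->
    on_path g3 r -> on_path g3 p -> ~ on_path g3 q -> False.
Proof.
move=> P Q R p1 q1 r1 q2 r2 p2 r3 p3 q3.
have [s | [s | s]] : ((x0 < xcoord g1 <-> x0 < xcoord g2) \/
                      (x0 < xcoord g2 <-> x0 < xcoord g3) \/
                      (x0 < xcoord g3 <-> x0 < xcoord g1))%Z by lia.
- by have [] := same_side_nested Q P R s q1 p1 q2 r2.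
- by have [] := same_side_nested R Q P s r2 q2 r3 p3.
- by have [] := same_side_nested P R Q s p3 r3 p1 q1.
Qed.

Lemma no_sun (p q r : bpath) (g0 g1 g2 g3 : gedge) :
    on_path g0 p -> on_path g0 q -> on_path g0 r ->
    on_path g1 p -> on_path g1 q -> ~ on_path g1 r ->
    on_path g2 q -> on_path g2 r -> ~ on_path g2 p ->
    on_path g3 r -> on_path g3 p -> ~ on_path g3 q -> False.
Proof.
case: g0 => x0 y0; first exact: no_sun_at_hedge.
rewrite -!(on_path_flip _ p) -!(on_path_flip _ q) -!(on_path_flip _ r).
exact: no_sun_at_hedge.
Qed.

(* The paths 0, 1, 3 form the central triangle; 2, 4, 5 are the straight paths
   lying over its sides. *)
Definition sun_paths : seq bpath :=
  [:: BP 0 0 1 1; BP 0 0 1 (-1); BP 0 0 1 0;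
      BP 0 (-1) 0 2; BP 0 0 0 1; BP 0 0 0 (-1)]%Z.

Lemma sun_LL_UL : shape_class S_LL_UL (@epg_graph sun_paths).
Proof.
apply: epg_graph_shape => p /=.
by do ![case=> [<- | ]] => //; split; try (by left); try (by right); rewrite /nonempty_path /=; lia.
Qed.

Lemma sun_not_Helly : ~ Helly_B1_EPG (@epg_graph sun_paths).
Proof.
case=> P [[ne rep] helly].
pose a : 'I_(size sun_paths) := @Ordinal 6 0 isT.
pose b : 'I_(size sun_paths) := @Ordinal 6 1 isT.
pose x : 'I_(size sun_paths) := @Ordinal 6 2 isT.
pose c : 'I_(size sun_paths) := @Ordinal 6 3 isT.
pose y : 'I_(size sun_paths) := @Ordinal 6 4 isT.
pose z : 'I_(size sun_paths) := @Ordinal 6 5 isT.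
(* The premise of [helly_family] also ranges over equal pairs. *)
have refl u : edge_meet (P u) (P u).
  by apply/edge_meetE; rewrite /meets /hmeet /vmeet; move: (ne u); rewrite /nonempty_path; lia.
have adj u v : epg_graph u v -> edge_meet (P u) (P v).
  by move=> uv; apply/rep => //; move=> E; move: uv; rewrite /epg_graph E eqxx.
have clique u v w : epg_graph u v -> epg_graph v w -> epg_graph w u ->
    exists g, [/\ on_path g (P u), on_path g (P v) & on_path g (P w)].
  move=> uv vw wu; have [g gP] : exists g, forall t, t \in [set u; v; w] -> on_path g (P t).
    apply: helly => s t; rewrite !inE.
    have sym := proj2 (epg_graph_simple sun_paths).
    by move=> /orP [/orP [] |] /eqP -> /orP [/orP [] |] /eqP ->;
      first [exact: refl | by apply: adj | by apply: adj; rewrite sym].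
  by exists g; split; apply: gP; rewrite !inE eqxx ?orbT.
have nadj u v g : u != v -> ~~ epg_graph u v -> on_path g (P u) -> ~ on_path g (P v).
  move=> /eqP nuv /negP nE gu gv; apply: nE; apply/rep => //; by exists g.
have [g0 [a0 b0 c0]] := clique a b c isT isT isT.
have [g1 [a1 b1 x1]] := clique a b x isT isT isT.
have [g2 [b2 c2 z2]] := clique b c z isT isT isT.
have [g3 [c3 a3 y3]] := clique c a y isT isT isT.
apply: (no_sun a0 b0 c0 a1 b1 _ b2 c2 _ c3 a3 _).
- exact: (nadj x c).
- exact: (nadj z a).
- exact: (nadj y b).
Qed.

(** * Representations of K_{2,4} *)

Definition opposite (p q : bpath) : Prop :=
  (((0 < bh p /\ bh q < 0) \/ (bh p < 0 /\ 0 < bh q)) /\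
   ((0 < bv p /\ bv q < 0) \/ (bv p < 0 /\ 0 < bv q)))%Z.

Definition HH (p q b : bpath) : Prop := hmeet b p /\ hmeet b q.
Definition VV (p q b : bpath) : Prop := vmeet b p /\ vmeet b q.
Definition HV (p q b : bpath) : Prop := hmeet b p /\ vmeet b q.

Lemma meets_both (p q b : bpath) : meets b p -> meets b q ->
  HH p q b \/ VV p q b \/ HV p q b \/ HV q p b.
Proof. by rewrite /HH /VV /HV => -[?|?] [?|?]; tauto. Qed.

Definition hstraddle (p : bpath) (x : Z) : Prop :=
  (Z.min (bx p) (bx p + bh p) < x < Z.max (bx p) (bx p + bh p))%Z.
Definition vstraddle (p : bpath) (y : Z) : Prop :=
  (Z.min (by_ p) (by_ p + bv p) < y < Z.max (by_ p) (by_ p + bv p))%Z.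

(** Stated by signs, so it holds for straight paths and follows from membership in either [S_LL] or
    [S_LL_UL_UR]. *)
Definition not_LR (p : bpath) : Prop := ~ (bh p < 0 /\ 0 < bv p)%Z.

(** An interval overlapping two disjoint ones contains the gap between them and a unit edge at
    either end of it; two such intervals therefore overlap. *)
Lemma interval_bridge (l1 r1 l2 r2 l r l' r' : Z) :
    (Z.max l l1 < Z.min r r1)%Z -> (Z.max l l2 < Z.min r r2)%Z ->
    (Z.max l' l1 < Z.min r' r1)%Z -> (Z.max l' l2 < Z.min r' r2)%Z ->
    ~ (Z.max l1 l2 < Z.min r1 r2)%Z ->
  (Z.max l l' < Z.min r r')%Z.
Proof. lia. Qed.

Lemma HH_unique (p q b b' : bpath) :
  ~ meets p q -> HH p q b -> HH p q b' -> meets b b'.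
Proof.
move=> npq [[e1 i1] [e2 i2]] [[e3 i3] [e4 i4]]; left; split; first by rewrite e1.
by apply: (interval_bridge i1 i2 i3 i4) => i; apply: npq; left; split; rewrite -?e1.
Qed.

Lemma VV_unique (p q b b' : bpath) :
  ~ meets p q -> VV p q b -> VV p q b' -> meets b b'.
Proof.
move=> npq [[e1 i1] [e2 i2]] [[e3 i3] [e4 i4]]; right; split; first by rewrite e1.
by apply: (interval_bridge i1 i2 i3 i4) => i; apply: npq; right; split; rewrite -?e1.
Qed.

(** Both bend at [(bx q, by_ p)], so disjointness makes their arms opposite. Since [p] meets the
    horizontal arms on both sides of this point, it is interior to [p]; likewise for [q]
    vertically. *)
Lemma HV_twins (p q b b' : bpath) : HV p q b -> HV p q b' -> ~ meets b b' ->
  [/\ opposite b b', hstraddle p (bx q) & vstraddle q (by_ p)].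
Proof.
move=> [h v] [h' v'] n.
have [hb _] := hmeet_neq0 h; have [hb' _] := hmeet_neq0 h'.
have [vb _] := vmeet_neq0 v; have [vb' _] := vmeet_neq0 v'.
have [eh ih] := h; have [ev iv] := v; have [eh' ih'] := h'; have [ev' iv'] := v'.
have ex : bx b = bx b' by rewrite ev.
have ey : by_ b = by_ b' by rewrite eh.
have nh : ~ hmeet b b' by move=> ?; apply: n; left.
have nv : ~ vmeet b b' by move=> ?; apply: n; right.
move: nh nv; rewrite hmeet_same_corner // vmeet_same_corner // => nh nv.
split; rewrite /opposite /hstraddle /vstraddle; first by clear - hb hb' vb vb' nh nv; lia.
- clear - ih ih' hb hb' nh ev ev' eh eh'; lia.
- clear - iv iv' vb vb' nv ev ev' eh eh'; lia.
Qed.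

Lemma HV_no_triplets (p q b b' b'' : bpath) :
    HV p q b -> HV p q b' -> HV p q b'' ->
    ~ meets b b' -> ~ meets b b'' -> ~ meets b' b'' -> False.
Proof.
move=> h h' h'' n n' n''.
have [o _ _] := HV_twins h h' n; have [o' _ _] := HV_twins h h'' n'.
have [o'' _ _] := HV_twins h' h'' n''.
by move: o o' o''; rewrite /opposite; lia.
Qed.

(* If all four types occur, [p] and [q] point in opposite directions from a
   common corner, and the two bends joining them fill the other two quadrants. *)
Lemma four_types_LR (p q b1 b2 b3 b4 : bpath) :
    ~ meets p q -> HH p q b1 -> VV p q b2 -> HV p q b3 -> HV q p b4 ->
    not_LR p -> not_LR q -> not_LR b3 -> not_LR b4 -> False.
Proof.
move=> n [hp hq] [vp vq] [hp3 vq3] [hq4 vp4].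
have ex : bx p = bx q by have [] := vp; have [] := vq; lia.
have ey : by_ p = by_ q by have [] := hp; have [] := hq; lia.
have [_ hp0] := hmeet_neq0 hp; have [_ hq0] := hmeet_neq0 hq.
have [_ vp0] := vmeet_neq0 vp; have [_ vq0] := vmeet_neq0 vq.
have nh : ~ hmeet p q by move=> ?; apply: n; left.
have nv : ~ vmeet p q by move=> ?; apply: n; right.
move: nh nv; rewrite hmeet_same_corner // vmeet_same_corner // => nh nv.
have [ey3 _] := hp3; have [ex3 _] := vq3; have [ey4 _] := hq4; have [ex4 _] := vp4.
move: hp3 vq3 hq4 vp4; rewrite /not_LR !hmeet_same_corner ?vmeet_same_corner; lia.
Qed.

(** [HH] puts [p] and [q] in one row, so the twins would bend at an end of the vertical arm of [q],
    not in its interior. *)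
Lemma HH_no_twins (p q b b1 b2 : bpath) :
  HH p q b -> HV p q b1 -> HV p q b2 -> meets b1 b2.
Proof.
move=> [[ep _] [eq _]] h1 h2; apply/meetsP/negPn/negP => /meetsP n.
by have [_ _] := HV_twins h1 h2 n; rewrite /vstraddle; lia.
Qed.

Lemma VV_no_twins (p q b b1 b2 : bpath) :
  VV p q b -> HV p q b1 -> HV p q b2 -> meets b1 b2.
Proof.
move=> [[ep _] [eq _]] h1 h2; apply/meetsP/negPn/negP => /meetsP n.
by have [_ + _] := HV_twins h1 h2 n; rewrite /hstraddle; lia.
Qed.

Lemma HHC (p q b : bpath) : HH p q b -> HH q p b. Proof. by case. Qed.
Lemma VVC (p q b : bpath) : VV p q b -> VV q p b. Proof. by case. Qed.

(** If [b1] is of type [HH] or [VV], no type can occur twice, so all four occur, against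
    [four_types_LR]. *)
Lemma K24_no_HH_VV (p q b1 b2 b3 b4 : bpath) :
    ~ meets p q ->
    [/\ not_LR p, not_LR q, not_LR b2, not_LR b3 & not_LR b4] ->
    [/\ ~ meets b1 b2, ~ meets b1 b3 & ~ meets b1 b4] ->
    [/\ ~ meets b2 b3, ~ meets b2 b4 & ~ meets b3 b4] ->
    [/\ meets b1 p, meets b2 p, meets b3 p & meets b4 p] ->
    [/\ meets b1 q, meets b2 q, meets b3 q & meets b4 q] ->
  HV p q b1 \/ HV q p b1.
Proof.
move=> npq [Lp Lq L2 L3 L4] [n12 n13 n14] [n23 n24 n34].
move=> [m1 m2 m3 m4] [m1' m2' m3' m4'].
have t2 := meets_both m2 m2'; have t3 := meets_both m3 m3'; have t4 := meets_both m4 m4'.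
have u b b' := @HH_unique p q b b' npq; have u' b b' := @VV_unique p q b b' npq.
have F := @four_types_LR p q _ _ _ _ npq.
case: (meets_both m1 m1') => [t | [t | ]] //; exfalso.
- have w b b' := @HH_no_twins p q b1 b b' t.
  have w' b b' := @HH_no_twins q p b1 b b' (HHC t).
  by case: t2 => [?|[?|[?|?]]]; case: t3 => [?|[?|[?|?]]]; case: t4 => [?|[?|[?|?]]]; eauto.
- have w b b' := @VV_no_twins p q b1 b b' t.
  have w' b b' := @VV_no_twins q p b1 b b' (VVC t).
  by case: t2 => [?|[?|[?|?]]]; case: t3 => [?|[?|[?|?]]]; case: t4 => [?|[?|[?|?]]]; eauto.
Qed.

(** * Further paths linking two of the [b]'s *)

Lemma hmeet_right (b c : bpath) : hmeet c b -> (0 < bh b)%Z ->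
  (bx b < Z.max (bx c) (bx c + bh c))%Z.
Proof. by case=> _; lia. Qed.

Lemma hmeet_left (b c : bpath) : hmeet c b -> (bh b < 0)%Z ->
  (Z.min (bx c) (bx c + bh c) < bx b)%Z.
Proof. by case=> _; lia. Qed.

Lemma hstraddle_hmeet (p c : bpath) (x : Z) :
    hstraddle p x -> by_ c = by_ p -> bh c <> 0%Z ->
    (Z.min (bx c) (bx c + bh c) <= x <= Z.max (bx c) (bx c + bh c))%Z ->
  hmeet c p.
Proof. by rewrite /hstraddle; split; lia. Qed.

Lemma vmeet_flip (p q : bpath) : vmeet p q = hmeet (flip p) (flip q).
Proof. by []. Qed.

(** The horizontal arm of [c] reaches the corner of the twins: it meets their opposite arms on both
    sides, or [c] bends in their column. As [p] runs through that corner, [c] meets it. *)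
Lemma twins_hlink (p q b b' c : bpath) :
    HV p q b -> HV p q b' -> opposite b b' -> hstraddle p (bx q) ->
  hmeet c b -> meets c b' -> hmeet c p.
Proof.
move=> [[eb _] [ebx _]] [[eb' _] [ebx' _]] [o _] s h m.
have [h0 _] := hmeet_neq0 h.
apply: (hstraddle_hmeet s) => //; first by have [-> _] := h.
case: m => [h' | [e _]]; last lia.
by case: o => -[o o'];
  have:= hmeet_left h; have:= hmeet_left h'; have:= hmeet_right h; have:= hmeet_right h'; lia.
Qed.

Lemma no_link_between_twins (p q b b' c : bpath) :
    HV p q b -> HV p q b' -> ~ meets b b' ->
  ~ meets c p -> ~ meets c q -> meets c b -> meets c b' -> False.
Proof.
move=> hb hb' n ncp ncq.
have [o s s'] := HV_twins hb hb' n.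
have nhp : ~ hmeet c p by move=> ?; apply: ncp; left.
have nvq : ~ vmeet c q by move=> ?; apply: ncq; right.
have o2 : opposite b' b by move: o; rewrite /opposite; tauto.
move=> [h|v] m'; first by apply: nhp (twins_hlink hb hb' o s h m').
case: m' => [h'|v'].
  by apply: nhp (twins_hlink hb' hb o2 s h' _); right.
(* Both contacts are vertical; reflection in the diagonal exchanges the roles of [p] and [q]. *)
rewrite vmeet_flip in nvq; apply: nvq.
apply: (@twins_hlink (flip q) (flip p) (flip b) (flip b')) => //.
- by case: hb.
- by case: hb'.
- by case: o.
- by left.
Qed.

Definition diagonal (p : bpath) : Prop :=
  ((0 < bh p /\ 0 < bv p) \/ (bh p < 0 /\ bv p < 0))%Z.

(** The other opposite pair, ⌟ and ⌜, contains the excluded shape. *)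
Lemma opposite_diagonal (p q : bpath) :
  opposite p q -> not_LR p -> not_LR q -> diagonal p /\ diagonal q.
Proof. rewrite /opposite /not_LR /diagonal; lia. Qed.

(* The link [c] bends at the corner of [p], so it leaves it away from [p], and
   [b] and [b'] both run towards that corner. *)
Lemma crossing_link_corner (p q b b' c : bpath) :
    HV p q b -> HV q p b' ->
    hstraddle p (bx q) -> hstraddle q (bx p) -> vstraddle p (by_ q) -> vstraddle q (by_ p) ->
    not_LR p -> not_LR q -> diagonal b -> diagonal b' ->
    ~ meets c p -> hmeet c b -> vmeet c b' ->
  (bh b < 0 <-> bh b' < 0)%Z.
Proof.
move=> [[eb _] [ebx _]] [[eb' _] [ebx' _]] sp sq tp tq Lp Lq db db' n h v.
have nh : ~ hmeet c p by move=> ?; apply: n; left.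
have nv : ~ vmeet c p by move=> ?; apply: n; right.
have [h0 _] := hmeet_neq0 h; have [v0 _] := vmeet_neq0 v.
have [ey _] := h; have [ex _] := v.
move: nh nv; rewrite hmeet_same_corner ?vmeet_same_corner; try lia.
have := hmeet_left h; have := hmeet_right h.
have := @hmeet_left (flip b') (flip c) v; have := @hmeet_right (flip b') (flip c) v.
move: sp sq tp tq Lp Lq db db'; rewrite /hstraddle /vstraddle /not_LR /diagonal /=.
clear - ebx eb' eb ebx' h0 v0 ey ex.
rewrite ebx eb' eb ebx' in ey ex *.
lia.
Qed.

Lemma crossing_link (p q b b' c : bpath) :
    HV p q b -> HV q p b' ->
    hstraddle p (bx q) -> hstraddle q (bx p) -> vstraddle p (by_ q) -> vstraddle q (by_ p) ->
    not_LR p -> not_LR q -> diagonal b -> diagonal b' ->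
    ~ meets c p -> ~ meets c q -> meets c b -> meets c b' ->
  (bh b < 0 <-> bh b' < 0)%Z.
Proof.
move=> hb hb' sp sq tp tq Lp Lq db db' np nq m m'.
case: m m' => [h | v] [h' | v'].
(* Two horizontal contacts would put [p] and [q] in one row, but [by_ q] is interior to the vertical
   arm of [p]. *)
- exfalso; have [[e1 _] _] := hb; have [[e2 _] _] := hb'.
  by have [e3 _] := h; have [e4 _] := h'; move: tp; rewrite /vstraddle; lia.
- exact: (crossing_link_corner hb hb' sp sq tp tq Lp Lq db db' np h v').
- exact: iff_sym (crossing_link_corner hb' hb sq sp tq tp Lq Lp db' db nq h' v).
- exfalso; have [_ [e1 _]] := hb; have [_ [e2 _]] := hb'.
  by have [e3 _] := v; have [e4 _] := v'; move: sp; rewrite /hstraddle; lia.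
Qed.

(** The links give [b1] and [b2] the horizontal direction of [b4], but twins have opposite ones. *)
Lemma K24_linked_twins (p q b1 b2 b3 b4 c d : bpath) :
    [/\ not_LR p, not_LR q, not_LR b1 & not_LR b2] -> not_LR b3 /\ not_LR b4 ->
    [/\ HV p q b1, HV p q b2, HV q p b3 & HV q p b4] ->
    ~ meets b1 b2 -> ~ meets b3 b4 ->
    [/\ ~ meets c p, ~ meets c q, meets c b1 & meets c b4] ->
    [/\ ~ meets d p, ~ meets d q, meets d b2 & meets d b4] -> False.
Proof.
move=> [Lp Lq L1 L2] [L3 L4] [h1 h2 h3 h4] n12 n34 [cp cq c1 c4] [dp dq d2 d4].
have [o12 sp tq] := HV_twins h1 h2 n12; have [o34 sq tp] := HV_twins h3 h4 n34.
have [D1 D2] := opposite_diagonal o12 L1 L2.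
have [_ D4] := opposite_diagonal o34 L3 L4.
have E1 := crossing_link h1 h4 sp sq tp tq Lp Lq D1 D4 cp cq c1 c4.
have E2 := crossing_link h2 h4 sp sq tp tq Lp Lq D2 D4 dp dq d2 d4.
by case: o12; lia.
Qed.

Lemma no_K24_linked (p q c d b1 b2 b3 b4 : bpath) :
    [/\ not_LR p, not_LR q, not_LR b1 & not_LR b2] -> not_LR b3 /\ not_LR b4 ->
    ~ meets p q ->
    [/\ ~ meets b1 b2, ~ meets b1 b3 & ~ meets b1 b4] ->
    [/\ ~ meets b2 b3, ~ meets b2 b4 & ~ meets b3 b4] ->
    [/\ meets b1 p, meets b2 p, meets b3 p & meets b4 p] ->
    [/\ meets b1 q, meets b2 q, meets b3 q & meets b4 q] ->
    [/\ ~ meets c p, ~ meets c q, meets c b1 & meets c b4] ->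
    [/\ ~ meets d p, ~ meets d q, meets d b2 & meets d b4] -> False.
Proof.
move=> [Lp Lq L1 L2] [L3 L4] n [n12 n13 n14] [n23 n24 n34] [p1 p2 p3 p4] [q1 q2 q3 q4].
move=> hc hd.
have sym b b' : ~ meets b b' -> ~ meets b' b by move=> nb /meetsC.
have t1 : HV p q b1 \/ HV q p b1 by apply: (@K24_no_HH_VV p q b1 b2 b3 b4).
have t2 : HV p q b2 \/ HV q p b2 by apply: (@K24_no_HH_VV p q b2 b1 b3 b4) => //; split; auto.
have t3 : HV p q b3 \/ HV q p b3 by apply: (@K24_no_HH_VV p q b3 b1 b2 b4) => //; split; auto.
have t4 : HV p q b4 \/ HV q p b4 by apply: (@K24_no_HH_VV p q b4 b1 b2 b3) => //; split; auto.
have [cp cq c1 c4] := hc; have [dp dq d2 d4] := hd.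
have sep x y : HV x y b1 -> HV x y b4 -> ~ meets c x -> ~ meets c y -> False.
  by move=> h1 h4 cx cy; apply: (no_link_between_twins h1 h4 n14 cx cy c1 c4).
have sep' x y : HV x y b2 -> HV x y b4 -> ~ meets d x -> ~ meets d y -> False.
  by move=> h2 h4 dx dy; apply: (no_link_between_twins h2 h4 n24 dx dy d2 d4).
(* The links keep [b1] and [b2] away from the crossing of [b4], so they share the other one, which
   has no room for [b3]. *)
case: t4 => h4.
- have h1 : HV q p b1 by case: t1 => // h1; case: (sep _ _ h1 h4 cp cq).
  have h2 : HV q p b2 by case: t2 => // h2; case: (sep' _ _ h2 h4 dp dq).
  have h3 : HV p q b3 by case: t3 => // h3; case: (HV_no_triplets h1 h2 h3 n12 n13 n23).
  exact: (@K24_linked_twins q p b1 b2 b3 b4 c d).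
- have h1 : HV p q b1 by case: t1 => // h1; case: (sep _ _ h1 h4 cq cp).
  have h2 : HV p q b2 by case: t2 => // h2; case: (sep' _ _ h2 h4 dq dp).
  have h3 : HV q p b3 by case: t3 => // h3; case: (HV_no_triplets h1 h2 h3 n12 n13 n23).
  exact: (@K24_linked_twins p q b1 b2 b3 b4 c d).
Qed.

Lemma shape_LL_signs (p : bpath) : shape_in S_LL p ->
  (bh p = 0 \/ bv p = 0 \/ (0 < bh p /\ 0 < bv p))%Z.
Proof.
rewrite /shape_in /S_LL /bend_shape.
case: (Z.eqb_spec (bh p) 0) => h0 /=; first by lia.
case: (Z.eqb_spec (bv p) 0) => v0 /=; first by lia.
by case: (Z.ltb_spec 0 (bh p)); case: (Z.ltb_spec 0 (bv p)); try lia.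
Qed.

Lemma shape_LL_UL_UR_not_LR (p : bpath) : shape_in S_LL_UL_UR p -> not_LR p.
Proof.
rewrite /shape_in /S_LL_UL_UR /bend_shape /not_LR.
case: (Z.eqb_spec (bh p) 0) => h0 /=; first by lia.
case: (Z.eqb_spec (bv p) 0) => v0 /=; first by lia.
by case: (Z.ltb_spec 0 (bh p)); case: (Z.ltb_spec 0 (bv p)); try lia; move=> _ _ [|[]].
Qed.

Lemma LL_no_twins (p q b b' : bpath) : shape_in S_LL b -> shape_in S_LL b' ->
  HV p q b -> HV p q b' -> meets b b'.
Proof.
move=> /shape_LL_signs s /shape_LL_signs s' h h'; apply/meetsP/negPn/negP => /meetsP n.
by have [[]] := HV_twins h h' n; lia.
Qed.

(** * The separating graphs *)

(** Paths 0 and 1 cross at [(2, 0)] and [(0, 2)]; each crossing carries a ⌞ and a ⌝. *)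
Definition K24_paths : seq bpath :=
  [:: BP 0 0 3 3; BP 2 2 (-3) (-3); BP 2 0 1 1; BP 2 0 (-1) (-1);
      BP 0 2 1 1; BP 0 2 (-1) (-1)]%Z.

Lemma K24_LL_UR : shape_class S_LL_UR (@epg_graph K24_paths).
Proof.
apply: epg_graph_shape => p /=.
by do ![case=> [<- | ]] => //; split; try (by left); try (by right); rewrite /nonempty_path /=; lia.
Qed.

Lemma epg_graph_meets (ps : seq bpath) (P : 'I_(size ps) -> bpath) :
  B1_EPG_rep (@epg_graph ps) P -> forall u v, epg_graph u v -> meets (P u) (P v).
Proof.
move=> [_ rep] u v uv; apply/edge_meetE/rep => // E.
by move: uv; rewrite /epg_graph E eqxx.
Qed.

Lemma epg_graph_not_meets (ps : seq bpath) (P : 'I_(size ps) -> bpath) :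
  B1_EPG_rep (@epg_graph ps) P ->
  forall u v, u != v -> ~~ epg_graph u v -> ~ meets (P u) (P v).
Proof.
move=> [_ rep] u v /eqP uv /negP n /edge_meetE m.
by apply: n; apply/rep.
Qed.

Lemma K24_not_LL : ~ shape_class S_LL (@epg_graph K24_paths).
Proof.
case=> P [rep sh].
pose v k (lt : k < 6) : 'I_(size K24_paths) := @Ordinal 6 k lt.
pose a1 := v 0 isT; pose a2 := v 1 isT.
pose b1 := v 2 isT; pose b2 := v 3 isT; pose b3 := v 4 isT; pose b4 := v 5 isT.
have M := epg_graph_meets rep; have N := epg_graph_not_meets rep.
have L u : not_LR (P u) by have := shape_LL_signs (sh u); rewrite /not_LR; lia.
have n12 := N b1 b2 isT isT; have n13 := N b1 b3 isT isT; have n14 := N b1 b4 isT isT.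
have n23 := N b2 b3 isT isT; have n24 := N b2 b4 isT isT; have n34 := N b3 b4 isT isT.
have n21 := N b2 b1 isT isT; have n31 := N b3 b1 isT isT; have n32 := N b3 b2 isT isT.
have na := N a1 a2 isT isT.
have T x y z w : [/\ ~ meets (P x) (P y), ~ meets (P x) (P z) & ~ meets (P x) (P w)] ->
    [/\ ~ meets (P y) (P z), ~ meets (P y) (P w) & ~ meets (P z) (P w)] ->
    [/\ epg_graph x a1, epg_graph y a1, epg_graph z a1 & epg_graph w a1] ->
    [/\ epg_graph x a2, epg_graph y a2, epg_graph z a2 & epg_graph w a2] ->
    HV (P a1) (P a2) (P x) \/ HV (P a2) (P a1) (P x).
  move=> nx ny [? ? ? ?] [? ? ? ?].
  by apply: (K24_no_HH_VV na _ nx ny); split; auto.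
have t1 : HV (P a1) (P a2) (P b1) \/ HV (P a2) (P a1) (P b1) by apply: (@T b1 b2 b3 b4).
have t2 : HV (P a1) (P a2) (P b2) \/ HV (P a2) (P a1) (P b2) by apply: (@T b2 b1 b3 b4).
have t3 : HV (P a1) (P a2) (P b3) \/ HV (P a2) (P a1) (P b3) by apply: (@T b3 b1 b2 b4).
have tw x y u u' := @LL_no_twins x y (P u) (P u') (sh u) (sh u').
(* Three vertices share two types, so two of them are twins. *)
by case: t1 => ?; case: t2 => ?; case: t3 => ?; eauto.
Qed.

(** A clique of a bipartite graph has at most two vertices, and a shared edge serves both. *)
Lemma bipartite_helly (T : finType) (e : rel T) (P : T -> bpath) (side : T -> bool) :
  B1_EPG_rep e P -> (forall u v, e u v -> side u != side v) -> helly_family P.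
Proof.
move=> [ne rep] bip A mt.
have [-> | [x xA]] := set_0Vmem A; first by exists (HE 0 0) => u; rewrite inE.
case: (boolP [forall y in A, y == x]) => [/forall_inP one | ].
  by have [g [gx _]] := mt x x xA xA; exists g => u /one /eqP ->.
rewrite negb_forall_in => /exists_inP [y yA nyx].
have [g [gx gy]] := mt x y xA yA; exists g => z zA.
have adj u v : u \in A -> v \in A -> u != v -> side u != side v.
  by move=> uA vA /eqP uv; apply: bip; apply/rep => //; apply: mt.
case: (eqVneq z x) => [-> // | nzx]; case: (eqVneq z y) => [-> // | nzy].
have := adj _ _ yA xA nyx; have := adj _ _ zA xA nzx; have := adj _ _ zA yA nzy.
by case: (side x); case: (side y); case: (side z).
Qed.

(* K_{2,4} with parts {0,1} and {4,5,6,7}, together with a vertex 2 adjacent to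
   4 and 7 and a vertex 3 adjacent to 5 and 7. *)
Definition linked_K24_paths : seq bpath :=
  [:: BP 0 0 3 3; BP 2 2 (-3) (-3); BP 2 2 1 1; BP 0 0 (-1) (-1);
      BP 2 0 1 4; BP 2 0 (-4) (-1); BP 0 2 (-1) 1; BP 0 2 4 (-4)]%Z.

Lemma linked_K24_Helly : Helly_B1_EPG (@epg_graph linked_K24_paths).
Proof.
exists (fun u : 'I_(size linked_K24_paths) => nth (BP 0 0 0 0)%Z linked_K24_paths u).
have rep : B1_EPG_rep (@epg_graph linked_K24_paths)
    (fun u : 'I_(size linked_K24_paths) => nth (BP 0 0 0 0)%Z linked_K24_paths u).
  apply: epg_graph_rep => p /=.
  by do ![case=> [<- | ]] => //; rewrite /nonempty_path /=; lia.
(* The linking vertices 2 and 3 are on the side of 0 and 1. *)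
split=> //; apply: (bipartite_helly (side := fun u : 'I_(size linked_K24_paths) => u < 4) rep).
case=> i lti [j ltj].
by do 8?[case: i lti => [|i] lti //]; do 8?[case: j ltj => [|j] ltj //].
Qed.

Lemma linked_K24_not_LL_UL_UR : ~ shape_class S_LL_UL_UR (@epg_graph linked_K24_paths).
Proof.
case=> P [rep sh].
pose v k (lt : k < 8) : 'I_(size linked_K24_paths) := @Ordinal 8 k lt.
have M := epg_graph_meets rep; have N := epg_graph_not_meets rep.
have L u : not_LR (P u) := shape_LL_UL_UR_not_LR (sh u).
apply: (@no_K24_linked (P (v 0 isT)) (P (v 1 isT)) (P (v 2 isT)) (P (v 3 isT))
          (P (v 4 isT)) (P (v 5 isT)) (P (v 6 isT)) (P (v 7 isT))).
all: first [by apply: N | by split; first [exact: L | exact: M | exact: N]].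
Qed.

Theorem theorem2p1 :
  proper_subclass (shape_class S_LL) (shape_class S_LL_UR) /\
  proper_subclass (shape_class S_LL_UR) Helly_B1_EPG /\
  incomparable Helly_B1_EPG (shape_class S_LL_UL) /\
  incomparable Helly_B1_EPG (shape_class S_LL_UL_UR).
Proof.
(* By monotonicity in the shape set, this one graph also separates from [S_LL_UR] and [S_LL_UL]. *)
have linked S : (forall s, S s -> S_LL_UL_UR s) ->
    separates Helly_B1_EPG (shape_class S).
  move=> sub; have sg := epg_graph_simple linked_K24_paths.
  exists _, (@epg_graph linked_K24_paths); split=> //; split; first exact: linked_K24_Helly.
  by move=> /(shape_class_mono sub sg) /linked_K24_not_LL_UL_UR.
have sun S : (forall s, S_LL_UL s -> S s) ->
    separates (shape_class S) Helly_B1_EPG.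
  move=> sub; have sg := epg_graph_simple sun_paths.
  exists _, (@epg_graph sun_paths); split=> //; split; last exact: sun_not_Helly.
  exact: shape_class_mono sub _ _ sg sun_LL_UL.
split; last split; last split.
- split; first by apply: shape_class_mono => s; left.
  exists _, (@epg_graph K24_paths); split; first exact: epg_graph_simple.
  by split; [exact: K24_LL_UR | exact: K24_not_LL].
- split; first exact: LL_UR_sub_Helly.
  by apply: linked => s [->|->]; rewrite /S_LL_UL_UR; tauto.
- split; first by apply: linked => s [->|->]; rewrite /S_LL_UL_UR; tauto.
  exact: sun.
- split; first exact: linked.
  by apply: sun => s [->|->]; rewrite /S_LL_UL_UR; tauto.
Qed.
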